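(* Assume the following (all notation is as defined in the context). The functions $f,h,l$ are proper lower semicontinuous convex, $f$ is Fréchet differentiable, and $l$ is strictly convex in the sense that its conjugate $l^*$ is Fréchet differentiable; the operators $\mathbf P$ and $\mathbf M_1$ are positive definite; the iteration (I) has at least one fixed point; and there is $\beta>0$ such that for every fixed point $(\mathbf x^\star,\mathbf s^\star)$ of (I), every $\mathbf x\in\mathcal X$ and every $\mathbf s\in\mathcal S$, $$\langle \mathbf x-\mathbf x^\star,\nabla f(\mathbf x)-\nabla f(\mathbf x^\star)\rangle\ \ge\ \beta\|\nabla f(\mathbf x)-\nabla f(\mathbf x^\star)\|^2_{\mathbf P^{-1}},$$ $$\langle \mathbf s-\mathbf s^\star,\nabla l^*(\mathbf s)-\nabla l^*(\mathbf s^\star)\rangle\ \ge\ \beta\|\nabla l^*(\mathbf s)-\nabla l^*(\mathbf s^\star)\|^2_{\mathbf M_1^{-1}}.$$ Let $\theta\in(3/4,1]$ and $\tau\in(0,2\beta)$, and let $\{(\mathbf x^k,\mathbf s^k)\}$ be a sequence generated by (I). Then for any fixed point $(\mathbf x^\star,\mathbf s^\star)$ of (I) and every $k$, $$\|(\mathbf x^{k+1},\mathbf s^{k+1})-(\mathbf x^\star,\mathbf s^\star)\|^2_{\mathbf P,\widetilde{\mathbf M}}-\|(\mathbf x^{k},\mathbf s^{k})-(\mathbf x^\star,\mathbf s^\star)\|^2_{\mathbf P,\widetilde{\mathbf M}}\ \le\ -\Big(1-\frac{\tau}{2\beta}\Big)\|\mathbf s^k-\mathbf s^{k+1}\|^2_{\mathbf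 M_1}-\frac{(4\theta-3)(2\beta-\tau)}{2\beta-4(1-\theta)\tau}\|\mathbf x^k-\mathbf x^{k+1}\|^2_{\mathbf P}.$$
   Context: $\mathcal X$ and $\mathcal S$ are real Hilbert spaces; $f:\mathcal X\to(-\infty,+\infty]$ and $h,l:\mathcal S\to(-\infty,+\infty]$; $h^*,l^*$ are the Legendre–Fenchel conjugates and $\partial h^*$ is the convex subdifferential. $\mathbf A:\mathcal X\to\mathcal S$ is a bounded linear operator with adjoint $\mathbf A^\top$. $\mathbf P$ on $\mathcal X$ and $\mathbf D$ on $\mathcal S$ are bounded self-adjoint linear operators, and $\tau,\sigma>0$, $\theta\in(3/4,1]$ are parameters. ''Positive definite'' means bounded, self-adjoint and bounded below by a positive multiple of the identity (hence boundedly invertible). Define $$\mathbf M=\tfrac{\tau}{\sigma}(\mathbf D-\tau\sigma\mathbf A\mathbf P^{-1}\mathbf A^\top),\quad \mathbf M_1=\tfrac{\tau}{\sigma}(\mathbf D-\theta\tau\sigma\mathbf A\mathbf P^{-1}\mathbf A^\top),\quad \mathbf M_2=\tau^2(1-\theta)\mathbf A\mathbf P^{-1}\mathbf A^\top,\quad \widetilde{\mathbf M}=\mathbf M_1+\mathbf M_2,$$ so that $\mathbf M=\mathbf M_1-\mathbf M_2$ (and $\mathbf M$ need not be positive semidefinite). For a self-adjoint operator $\mathbf Q$, $\|\mathbf v\|^2_{\mathbf Q}:=\langle \mathbf v,\mathbf Q\mathbf v\rangle$, and $\|(\mathbf x,\mathbf s)\|^2_{\mathbf P,\mathbf Q}:=\|\mathbf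 x\|^2_{\mathbf P}+\|\mathbf s\|^2_{\mathbf Q}$. Iteration (I): given $(\mathbf x^k,\mathbf s^k)\in\mathcal X\times\mathcal S$, $$\mathbf s^{k+1}=(\mathbf D+\sigma\partial h^* )^{-1}\Big(\tfrac{\sigma}{\tau}\mathbf M\mathbf s^k+\sigma\mathbf A\big(\mathbf x^k-\tau\mathbf P^{-1}\nabla f(\mathbf x^k)\big)-\sigma\nabla l^*(\mathbf s^k)\Big),$$ $$\mathbf x^{k+1}=\mathbf x^k-\tau\mathbf P^{-1}\nabla f(\mathbf x^k)-\tau\mathbf P^{-1}\mathbf A^\top\mathbf s^{k+1}.$$ A fixed point of (I) is a pair $(\mathbf x^\star,\mathbf s^\star)$ that (I) maps to itself. *)

(* Defs.v *)
From HB Require Import structures.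
From mathcomp Require Import all_boot all_order all_algebra.
From mathcomp Require Import sesquilinear.
From mathcomp Require Import all_classical all_reals all_analysis.

Set Implicit Arguments.
Unset Strict Implicit.
Unset Printing Implicit Defensive.

Import Order.TTheory GRing.Theory Num.Theory.
Import numFieldNormedType.Exports.

Local Open Scope classical_set_scope.
Local Open Scope ring_scope.

(* A real Hilbert space: a Banach space whose norm comes from an inner product. *)
HB.mixin Record CompleteNormedModule_isHilbert (R : realType) H
    of CompleteNormedModule R H := {
  inner : {dot H for (idfun : R -> R)} ;
  inner_norm : forall x : H, inner x x = `|x| ^+ 2
}.

#[short(type="hilbertType")]
HB.structure Definition Hilbert (R : realType) :=
  {H of CompleteNormedModule_isHilbert R H & CompleteNormedModule R H}.

Notation "''[' u , v ]" := (inner u%R v%R) : ring_scope.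

Section operators.
Context {R : realType}.

Definition bounded_op {U V : normedModType R} (f : U -> V) :=
  exists C : R, forall x, `|f x| <= C * `|x|.

(* For a bounded linear A between Hilbert spaces such a map exists and is
   unique, by Riesz representation. *)
Definition adjoint {U V : hilbertType R} (A : U -> V) : V -> U :=
  get [set B : V -> U | forall u v, '[A u, v] = '[u, B v]].

Definition self_adjoint {H : hilbertType R} (Q : H -> H) :=
  forall u v, '[Q u, v] = '[u, Q v].

Definition positive_definite {H : hilbertType R} (Q : H -> H) :=
  [/\ linear Q, bounded_op Q, self_adjoint Q &
      exists2 c : R, 0 < c & forall v, c * `|v| ^+ 2 <= '[v, Q v]].

(* The two-sided inverse of a bijective Q; positive definite operators are
   bijective. *)
Definition inv_op {H : hilbertType R} (Q : H -> H) : H -> H := pinv setT Q.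

(* The quadratic form written as a squared norm; Q need not be positive. *)
Definition qnorm2 {H : hilbertType R} (Q : H -> H) (v : H) : R := '[v, Q v].

Definition qnorm2_pair {U V : hilbertType R} (P : U -> U) (Q : V -> V)
  (z : U * V) : R := qnorm2 P z.1 + qnorm2 Q z.2.

End operators.

Section convex_analysis.
Context {R : realType} {H : hilbertType R}.
Local Open Scope ereal_scope.
Implicit Types f : H -> \bar R.

Definition proper_fun f :=
  (forall x, f x != -oo) /\ (exists x, f x != +oo).

(* Only applied to functions that avoid -oo, so that the right-hand side is
   never of the form oo - oo. *)
Definition convex_efun f := forall (x y : H) (t : R), (0 <= t <= 1)%R ->
  f (t *: x + (1 - t) *: y)%R <= t%:E * f x + (1 - t)%:E * f y.

Definition proper_lsc_convex f :=
  [/\ proper_fun f, lower_semicontinuous f & convex_efun f].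

Definition conjugate f (u : H) : \bar R :=
  ereal_sup [set '[u, s]%:E - f s | s in [set: H]].

(* The subdifferential is empty outside the effective domain. *)
Definition subdifferential f (s : H) : set H :=
  [set u | f s \is a fin_num /\
           forall s', f s + '[u, s' - s]%:E <= f s'].

(* Differentiability of an extended-valued function on the whole space includes
   finiteness, without which fine would hide infinite values. *)
Definition frechet_differentiable f :=
  (forall x, f x \is a fin_num) /\
  (forall x, differentiable (fine \o f : H -> R^o) x).

(* The Riesz representative of the Frechet derivative. *)
Definition gradient f (x : H) : H :=
  get [set g : H | forall v, 'd (fine \o f : H -> R^o) x v = '[g, v]].

End convex_analysis.

Section iteration.
Context {R : realType} {X S : hilbertType R}.
Variables (tau sigma theta : R).
Variables (A : X -> S) (P : X -> X) (D : S -> S).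

Definition APA (s : S) : S := A (inv_op P (adjoint A s)).

Definition opM (s : S) : S :=
  (tau / sigma) *: (D s - (tau * sigma) *: APA s).

Definition opM1 (s : S) : S :=
  (tau / sigma) *: (D s - (theta * tau * sigma) *: APA s).

Definition opM2 (s : S) : S := (tau ^+ 2 * (1 - theta)) *: APA s.

Definition opMt (s : S) : S := opM1 s + opM2 s.

(* The values at u of the set-valued inverse of D + sigma * (subdifferential of g). *)
Definition resolvent (g : S -> \bar R) (u : S) : set S :=
  [set s | exists2 p, subdifferential g s p & u = D s + sigma *: p].

Variables (f : X -> \bar R) (h l : S -> \bar R).

Definition grad_step (x : X) : X := x - tau *: inv_op P (gradient f x).

(* The iteration maps z to z'. *)
Definition step (z z' : X * S) :=
  resolvent (conjugate h)
    ((sigma / tau) *: opM z.2 + sigma *: A (grad_step z.1)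
       - sigma *: gradient (conjugate l) z.2) z'.2 /\
  z'.1 = grad_step z.1 - tau *: inv_op P (adjoint A z'.2).

Definition fixed_point (z : X * S) := step z z.

End iteration.

(* Main.v *)
Require Import Defs.
From HB Require Import structures.
From mathcomp Require Import all_boot all_order all_algebra.
From mathcomp Require Import sesquilinear.
From mathcomp Require Import all_classical all_reals all_analysis.
From mathcomp Require Import ring lra.

Set Implicit Arguments.
Unset Strict Implicit.
Unset Printing Implicit Defensive.

Import Order.TTheory GRing.Theory Num.Theory.
Import numFieldNormedType.Exports.

Local Open Scope ring_scope.

(** The estimate is a Fejer-type inequality.  Write [a], [b] for the dual errors
    of [s k], [s k.+1] and [e], [c] for the primal errors of [x k], [x k.+1], so
    that [s k - s k.+1 = a - b] and [x k - x k.+1 = e - c].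

    Subtracting the optimality relations of the step and of the fixed point, and
    using that the subdifferential of the conjugate of [h] is monotone, gives
    [step_monotone]: [tau] times the gradient differences, paired with [c] and
    [b], is at most [<b, M (a - b)> + <c, P (e - c)>].  Polarization turns this
    bound into differences of squared distances.  The gradients are evaluated at
    the old iterate but tested against the new error; cocoercivity absorbs this
    mismatch on the dual side ([cocoercive_bound]) at the price of
    [tau / (2 beta)] times the squared [M1]-length of [a - b].

    Since [M = M1 - M2], the [M2]-terms have the wrong sign for the metric
    [M1 + M2].  The excess [2 |b|^2_M2 - 2 |a|^2_M2 + |a - b|^2_M2] is at most
    [4 |b|^2_M2] by the parallelogram identity.  The primal update expresses
    [tau P^-1 A^T b] as [(e - c) - y] where
    [y = tau P^-1 (grad f x - grad f xs)] ([step_dual_error_image]), so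
    [4 |b|^2_M2] equals [4 (1 - theta) |(e - c) - y|^2_P], a purely primal
    quantity.  It remains to maximise a concave quadratic in [y]
    ([primal_quadratic_bound]); the condition [theta > 3/4] makes the resulting
    coefficient of [|e - c|^2_P] negative.

    Two facts about Hilbert spaces support the computation: bounded operators
    have adjoints and positive definite operators are onto.  Both follow from
    one symmetric Lax-Milgram theorem ([coercive_representation]), proved by
    minimising a quadratic energy. *)

(** * Inner products *)

Section inner.
Context {R : realType} {H : hilbertType R}.
Implicit Types (u v w : H) (a : R).

Lemma innerC u v : '[u, v] = '[v, u].
Proof. by have /= := hermC (@inner R H) u v; rewrite expr0 mul1r. Qed.

Lemma innerDl u v w : '[u + v, w] = '[u, w] + '[v, w].
Proof. exact: linearDl. Qed.

Lemma innerZl a u v : '[a *: u, v] = a * '[u, v].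
Proof. exact: linearZl_LR. Qed.

Lemma innerBl u v w : '[u - v, w] = '[u, w] - '[v, w].
Proof. exact: linearBl. Qed.

Lemma inner0l u : '[0, u] = 0.
Proof. exact: linear0l. Qed.

Lemma innerDr u v w : '[w, u + v] = '[w, u] + '[w, v].
Proof. by rewrite !(innerC w) innerDl. Qed.

Lemma innerZr a u v : '[v, a *: u] = a * '[v, u].
Proof. by rewrite !(innerC v) innerZl. Qed.

Lemma innerBr u v w : '[w, u - v] = '[w, u] - '[w, v].
Proof. by rewrite !(innerC w) innerBl. Qed.

Lemma inner_ge0 u : 0 <= '[u, u].
Proof. by rewrite inner_norm exprn_ge0. Qed.

Lemma inner_inj u v : (forall w, '[w, u] = '[w, v]) -> u = v.
Proof.
move=> uv; apply/eqP; rewrite -subr_eq0 -normr_eq0 -sqrf_eq0 -inner_norm.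
by rewrite innerBr uv subrr.
Qed.

End inner.

(* The rules for differences come first: a difference also matches as a sum. *)
Definition innerE := (@innerBl, @innerBr, @innerDl, @innerDr,
  @innerZl, @innerZr).

Lemma cauchy_schwarz {R : realType} {H : hilbertType R} (u v : H) :
  `|'[u, v]| <= `|u| * `|v|.
Proof.
rewrite -ler_sqr ?nnegrE ?mulr_ge0// exprMn -!inner_norm.
rewrite -normrX ger0_norm ?sqr_ge0//.
have [->|v0] := eqVneq v 0; first by rewrite innerC !inner0l expr0n /= mulr0.
have vv : 0 < '[v, v] by rewrite inner_norm exprn_gt0// normr_gt0.
have := inner_ge0 ('[v, v] *: u - '[u, v] *: v).
rewrite !innerE (innerC v u).
set a := '[u, u]; set b := '[v, v]; set c := '[u, v] => h.
have : 0 <= b * (a * b - c ^+ 2) by congr (_ <= _): h; ring.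
by rewrite pmulr_rge0// subr_ge0.
Qed.

Lemma innerr_cvg {R : realType} {H : hilbertType R} (u : nat -> H) (v w : H) :
  (u @ \oo --> w)%classic -> ((fun n => '[v, u n]) @ \oo --> '[v, w])%classic.
Proof.
move=> uw; apply/cvgrPdist_le => e e0.
have v1 : 0 < `|v| + 1 by rewrite ltr_wpDl.
move/cvgrPdist_le : uw => /(_ (e / (`|v| + 1))).
rewrite divr_gt0// => /(_ isT); apply: filterS => n un.
rewrite -innerBr (le_trans (cauchy_schwarz _ _))//.
rewrite (le_trans (ler_wpM2l (normr_ge0 _) un))//.
by rewrite mulrCA ger_pMr// ler_pdivrMr// mul1r lerDl.
Qed.

(** * Nonnegative quadratic forms *)

Section positive.
Context {R : realType} {H : hilbertType R} (Q : H -> H).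
Hypotheses (linQ : linear Q) (symQ : self_adjoint Q).
Hypothesis posQ : forall v, 0 <= '[v, Q v].
Implicit Types (u v w : H) (a : R).

Lemma qform_sym u v : '[u, Q v] = '[v, Q u].
Proof. by rewrite innerC symQ. Qed.

Lemma qformB u v : '[u - v, Q (u - v)] = '[u, Q u] - 2 * '[u, Q v] + '[v, Q v].
Proof.
by rewrite (zmod_morphism_linear linQ) !innerE (qform_sym v u); ring.
Qed.

Lemma polarization u v :
  2 * '[v, Q (u - v)] = '[u, Q u] - '[v, Q v] - '[u - v, Q (u - v)].
Proof.
by rewrite qformB (zmod_morphism_linear linQ) !innerE (qform_sym v u); ring.
Qed.

(** The two sides differ by the form at [u + v]. *)
Lemma parallelogram_le u v :
  '[u - v, Q (u - v)] <= 2 * '[u, Q u] + 2 * '[v, Q v].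
Proof.
have := posQ (1 *: u + v).
by rewrite qformB linQ !scale1r !innerE (qform_sym v u); lra.
Qed.

(** Nonnegativity of the form at [u - a *: v]. *)
Lemma young a u v : 0 < a ->
  2 * '[u, Q v] <= a^-1 * '[u, Q u] + a * '[v, Q v].
Proof.
move=> a0; have := posQ (u - a *: v).
rewrite qformB (scalable_linear linQ) !innerE => /(mulr_ge0 (ltW (_ : 0 < a^-1))).
rewrite invr_gt0 => /(_ a0).
have -> : a^-1 * ('[u, Q u] - 2 * (a * '[u, Q v]) + a * (a * '[v, Q v])) =
  a^-1 * '[u, Q u] + a * '[v, Q v] - 2 * '[u, Q v] by field; rewrite gt_eqF.
by rewrite subr_ge0.
Qed.

End positive.

(** * Positive definite operators and adjoints *)

(** Symmetric Lax-Milgram, by minimising the energy [J v = <v, Q v> - 2 phi v].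
    Coercivity bounds [J] from below, and the parallelogram identity makes a
    minimising sequence Cauchy.  Its limit [w] inherits the first-order condition
    from the near-optimality of the sequence in every direction, without
    continuity of [Q].  With [Q] the identity this is the Riesz representation
    theorem; with [phi] an inner product it is surjectivity of [Q]. *)
Lemma coercive_representation {R : realType} {H : hilbertType R} (Q : H -> H)
  (phi : H -> R) (c C : R) :
  linear Q -> self_adjoint Q ->
  0 < c -> (forall v, c * `|v| ^+ 2 <= '[v, Q v]) ->
  scalar phi -> (forall v, `|phi v| <= C * `|v|) ->
  exists w, forall v, '[v, Q w] = phi v.
Proof.
move=> linQ symQ c0 coeQ linphi bphi.
pose J v := '[v, Q v] - 2 * phi v.
have JD u v t : J (u + t *: v) =
    J u + 2 * t * ('[v, Q u] - phi v) + t ^+ 2 * '[v, Q v].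
  rewrite /J [u + _]addrC linphi linQ !innerE (qform_sym symQ u v).
  by ring.
have J_ge v : - (C ^+ 2 / c) <= J v.
  rewrite -(ler_pM2l c0) mulrN mulrCA divff ?gt_eqF// mulr1.
  have sq := sqr_ge0 (c * `|v| - C).
  have coe := ler_wpM2l (ltW c0) (coeQ v).
  have := ler_wpM2l (ltW c0) (le_trans (ler_norm _) (bphi v)).
  by rewrite /J; lra.
pose E := range J.
have infE : has_inf E.
  by split; [exists (J 0), 0 | exists (- (C ^+ 2 / c)) => _ [v _ <-]].
pose m := inf E.
have J_gem v : m <= J v by apply: ge_inf; [case: infE | exists v].
have /choice[u uP] : forall n, exists w, J w < m + n.+1%:R^-1.
  move=> n.
  have [|_ [w _ <-] Jw] := @inf_adherent _ E n.+1%:R^-1 _ infE.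
    by rewrite invr_gt0 ltr0n.
  by exists w.
have uB n k : c * `|u n - u k| ^+ 2 <= 2 * (n.+1%:R^-1 + k.+1%:R^-1).
  apply: (le_trans (coeQ _)).
  have := uP n; have := uP k.
  (* The infimum is compared with the value at the midpoint. *)
  have := J_gem (u n + - 2^-1 *: (u n - u k)); rewrite JD.
  move: (u n) (u k) => a b.
  rewrite /J qformB// !innerE.
  have -> : phi (a - b) = phi a - phi b.
    by rewrite addrC -scaleN1r linphi; ring.
  rewrite (qform_sym symQ b a).
  move: n.+1%:R^-1 k.+1%:R^-1 => en ek; rewrite sqrrN exprVn; lra.
have cvgu : cvgn u.
  apply/cauchy_cvgP/cauchy_ballP => e e0; near_simpl.
  have ce : 0 < c * e ^+ 2 / 4 by rewrite divr_gt0// mulr_gt0// exprn_gt0.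
  have := @cvg_harmonic R; move/cvgrPdist_lt => /(_ _ ce) [N _ NP].
  have {}NP n : (N <= n)%N -> n.+1%:R^-1 < c * e ^+ 2 / 4.
    by move=> /NP; rewrite /= sub0r normrN ger0_norm.
  exists ([set n | (N <= n)%N], [set n | (N <= n)%N])%classic.
    by split; exists N.
  move=> [n k] /= [Nn Nk]; rewrite -ball_normE /=.
  suff : c * `|u n - u k| ^+ 2 < c * e ^+ 2.
    by rewrite ltr_pM2l// ltr_sqr ?nnegrE// ltW.
  apply: le_lt_trans (uB n k) _.
  move: (NP n Nn) (NP k Nk); move: n.+1%:R^-1 k.+1%:R^-1 => p q; lra.
pose w := limn u.
have uw : (u @ \oo --> w)%classic by [].
exists w => v.
set q := '[v, Q v].
have q0 : 0 <= q.
  by apply: le_trans (coeQ v); rewrite mulr_ge0 ?exprn_ge0// ltW.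
set g := '[v, Q w] - phi v.
have ge0 t : 0 <= 2 * t * g + t ^+ 2 * q.
  have cvgg : ((fun n => 2 * t * ('[Q v, u n] - phi v) + t ^+ 2 * q
      + n.+1%:R^-1) @ \oo
      --> 2 * t * ('[Q v, w] - phi v) + t ^+ 2 * q + 0)%classic.
    apply: cvgD; last exact: cvg_harmonic.
    apply: cvgD; last exact: cvg_cst.
    apply: cvgMr; apply: cvgB; last exact: cvg_cst.
    exact: innerr_cvg.
  have := cvgr_to_ge cvgg; rewrite addr0 symQ -/g; apply.
  apply: nearW => n; have := J_gem (u n + t *: v); rewrite JD -/q symQ.
  by move: (uP n); move: n.+1%:R^-1 => en; lra.
(* The optimal - g / q would need q != 0. *)
have := ge0 (- g / (q + 1)).
have -> : 2 * (- g / (q + 1)) * g + (- g / (q + 1)) ^+ 2 * q =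
    - (g ^+ 2 * ((q + 2) / (q + 1) ^+ 2)).
  by field; lra.
rewrite oppr_ge0 pmulr_lle0; last by rewrite divr_gt0 ?exprn_gt0//; lra.
by move=> g0; apply/eqP; rewrite -subr_eq0 -sqrf_eq0 eq_le g0 sqr_ge0.
Qed.

Section positive_definite.
Context {R : realType} {H : hilbertType R} (Q : H -> H).
Hypothesis pdQ : positive_definite Q.
Implicit Types (u v : H).

Lemma positive_definite_ge0 v : 0 <= '[v, Q v].
Proof.
have [_ _ _ [c c0 cQ]] := pdQ.
by apply: le_trans (cQ v); rewrite mulr_ge0 ?exprn_ge0// ltW.
Qed.

Lemma positive_definite_inj : injective Q.
Proof.
have [linQ _ _ [c c0 cQ]] := pdQ.
move=> u v uv; apply/eqP; rewrite -subr_eq0 -normr_eq0 -sqrf_eq0 eq_le sqr_ge0.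
have := cQ (u - v); rewrite (zmod_morphism_linear linQ) uv subrr innerC inner0l.
by rewrite pmulr_rle0// => ->.
Qed.

Lemma inv_opK v : Q (inv_op Q v) = v.
Proof.
have [linQ _ symQ [c c0 cQ]] := pdQ.
have [w wP] : exists w, forall u, '[u, Q w] = '[v, u].
  apply: (coercive_representation (C := `|v|) linQ symQ c0 cQ).
    by move=> a x y; rewrite !innerE.
  by move=> u; exact: cauchy_schwarz.
apply: pinvK; rewrite inE; exists w => //.
by apply: inner_inj => u; rewrite wP innerC.
Qed.

Lemma inv_op_linear : linear (inv_op Q).
Proof.
have [linQ _ _ _] := pdQ.
by move=> a u v; apply: positive_definite_inj; rewrite linQ !inv_opK.
Qed.

Lemma inv_op_self_adjoint : self_adjoint (inv_op Q).
Proof.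
have [_ _ symQ _] := pdQ.
by move=> u v; rewrite -{1}(inv_opK v) -symQ inv_opK.
Qed.

Lemma inv_op_ge0 v : 0 <= '[v, inv_op Q v].
Proof. by rewrite -{1}(inv_opK v) innerC positive_definite_ge0. Qed.

(** Bounds [- 2 <b, y>] by splitting it as [- 2 <a, y> + 2 <a - b, y>]: the second
    part is controlled by [young] with parameter [2 * beta], chosen so that the
    term in [y] cancels against cocoercivity at [a]. *)
Lemma cocoercive_bound (beta : R) (a b y : H) : 0 < beta ->
  beta * qnorm2 (inv_op Q) y <= '[a, y] ->
  - 2 * '[b, y] <= (2 * beta)^-1 * '[a - b, Q (a - b)].
Proof.
move=> beta0; have [linQ _ symQ _] := pdQ; rewrite /qnorm2 => cy.
have := @young _ _ _ linQ symQ positive_definite_ge0 (2 * beta) (a - b)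
  (inv_op Q y).
rewrite inv_opK mulr_gt0// (innerC (inv_op Q y)) innerBl => /(_ isT).
lra.
Qed.

End positive_definite.

Section adjoint.
Context {R : realType} {U V : hilbertType R} (A : {linear U -> V}).
Hypothesis bA : bounded_op A.

Lemma adjointP u v : '[A u, v] = '[u, adjoint A v].
Proof.
move: u v; apply: (@getPex _
  [set B : V -> U | forall u v, '[A u, v] = '[u, B v]]%classic).
have [C AC] := bA.
suff /choice[B BP] : forall v, exists w, forall u, '[u, w] = '[A u, v].
  by exists B => u v; rewrite BP.
move=> v.
apply: (@coercive_representation _ _ id (fun u => '[A u, v]) 1 (C * `|v|)) => //.
- by move=> u; rewrite mul1r inner_norm.
- by move=> a x y; rewrite linearP !innerE.
- move=> u; apply: le_trans (cauchy_schwarz _ _) _.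
  by rewrite mulrAC ler_wpM2r.
Qed.

Lemma adjoint_linear : linear (adjoint A).
Proof.
move=> a u v; apply: inner_inj => w.
by rewrite -adjointP !innerE !adjointP.
Qed.

End adjoint.

(** * Monotonicity of the subdifferential *)

Lemma subdifferential_monotone {R : realType} {H : hilbertType R}
  (g : H -> \bar R) (s t p q : H) :
  subdifferential g s p -> subdifferential g t q -> 0 <= '[t - s, q - p].
Proof.
move=> [gs /(_ t) sp] [gt /(_ s) tq]; move: sp tq.
move: (g s) (g t) gs gt => [a| |] [b| |] //= _ _.
rewrite -!EFinD !lee_fin !innerE (innerC p) (innerC p) (innerC q) (innerC q).
lra.
Qed.

(** * Optimality relations of the iteration *)

Section iteration.
Context {R : realType} {X S : hilbertType R}.
Variables (tau sigma theta : R).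
Variables (A : {linear X -> S}) (P : {linear X -> X}) (D : {linear S -> S}).
Hypotheses (bA : bounded_op A) (pdP : positive_definite P).
Hypotheses (tau0 : 0 < tau) (sigma0 : 0 < sigma) (theta1 : theta <= 1).

Lemma APA_linear : linear (APA A P).
Proof.
move=> a u v; rewrite /APA (adjoint_linear bA) (inv_op_linear pdP).
by rewrite linearP.
Qed.

Lemma APA_inner u v :
  '[u, APA A P v] = '[adjoint A u, inv_op P (adjoint A v)].
Proof. by rewrite innerC (adjointP bA) innerC. Qed.

Lemma opM2_linear : linear (opM2 tau theta A P).
Proof.
move=> a u v; rewrite /opM2 APA_linear scalerDr !scalerA.
by rewrite [a * _]mulrC.
Qed.

Lemma opM2_inner u v : '[u, opM2 tau theta A P v] =
  tau ^+ 2 * (1 - theta) * '[adjoint A u, inv_op P (adjoint A v)].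
Proof. by rewrite innerZr APA_inner. Qed.

Lemma opM2_self_adjoint : self_adjoint (opM2 tau theta A P).
Proof.
move=> u v; rewrite innerC !opM2_inner; congr (_ * _).
by rewrite -(inv_op_self_adjoint pdP) innerC.
Qed.

Lemma opM2_ge0 v : 0 <= '[v, opM2 tau theta A P v].
Proof.
rewrite opM2_inner; apply: mulr_ge0; last exact: inv_op_ge0.
by rewrite mulr_ge0 ?sqr_ge0 ?subr_ge0.
Qed.

Lemma opM_split u v : '[u, opM tau sigma A P D v] =
  '[u, opM1 tau sigma theta A P D v] - '[u, opM2 tau theta A P v].
Proof. by rewrite !innerE; field; rewrite gt_eqF. Qed.

Variables (f : X -> \bar R) (h l : S -> \bar R).
Local Notation stepI := (step tau sigma A P D f h l).

Lemma step_primal z z' : stepI z z' ->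
  P (z.1 - z'.1) = tau *: (gradient f z.1 + adjoint A z'.2).
Proof.
move=> [_ ->]; rewrite /grad_step -addrA -opprD subKr.
by rewrite -scalerDr linearZ_LR linearD !(inv_opK pdP).
Qed.

(** The gradient step in the argument of the resolvent differs from the new primal
    iterate by [tau P^-1 A^T] of the new dual iterate.  Its image under [A] is the
    [APA] term that completes [D] to [opM] at the new dual iterate, so that [opM]
    acts on the dual increment only. *)
Lemma step_dual z z' : stepI z z' ->
  exists2 p, subdifferential (conjugate h) z'.2 p &
    tau *: p = opM tau sigma A P D (z.2 - z'.2)
               + tau *: (A z'.1 - gradient (conjugate l) z.2).
Proof.
move=> [[p hp eqp] eqx]; exists p => //.
have grad_stepE : A (grad_step tau P f z.1) = A z'.1 + tau *: APA A P z'.2.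
  by rewrite eqx [in RHS]linearB linearZ_LR subrK.
apply: inner_inj => v; move: eqp => /(congr1 (fun u => '[v, u])).
rewrite grad_stepE /opM (zmod_morphism_linear APA_linear) (linearB D) !innerE.
have t0 : tau != 0 by rewrite gt_eqF.
have s0 : sigma != 0 by rewrite gt_eqF.
move=> /esym/(canRL (addKr _)) eqv.
by apply: (mulfI s0); rewrite [LHS]mulrCA eqv; field; rewrite t0 s0.
Qed.

Variables (z z' zs : X * S).
Hypotheses (zz' : stepI z z') (zs_fixed : fixed_point tau sigma A P D f h l zs).

Lemma fixed_gradient : gradient f zs.1 = - adjoint A zs.2.
Proof.
have := step_primal zs_fixed; rewrite subrr linear0 => /esym/eqP.
by rewrite scaler_eq0 gt_eqF//= addr_eq0 => /eqP.
Qed.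

(** The primal update determines the image of the new dual error under
    [tau P^-1 A^T]; this is how a dual [M2]-length becomes a primal [P]-length. *)
Lemma step_dual_error_image : tau *: inv_op P (adjoint A (z'.2 - zs.2)) =
  (z.1 - z'.1) - tau *: inv_op P (gradient f z.1 - gradient f zs.1).
Proof.
apply: (positive_definite_inj pdP).
rewrite linearB (step_primal zz') !linearZ_LR /= !(inv_opK pdP).
rewrite (zmod_morphism_linear (adjoint_linear bA)) -scalerDr; congr (_ *: _).
by rewrite fixed_gradient opprK opprD addrACA subrr add0r.
Qed.

(** The subgradients selected by the step and by the fixed point are paired with
    the new dual error.  The coupling through [A] is moved to the primal side by
    the adjoint, where the primal update replaces it by the primal increment. *)
Lemma step_monotone :
  tau * '[z'.1 - zs.1, gradient f z.1 - gradient f zs.1]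
  + tau * '[z'.2 - zs.2,
            gradient (conjugate l) z.2 - gradient (conjugate l) zs.2]
  <= '[z'.2 - zs.2, opM tau sigma A P D (z.2 - z'.2)]
     + '[z'.1 - zs.1, P (z.1 - z'.1)].
Proof.
have [p hp] := step_dual zz'; have [q hq] := step_dual zs_fixed.
have M0 : opM tau sigma A P D 0 = 0.
  have APA0 := zmod_morphism_linear APA_linear 0 0; rewrite !subrr in APA0.
  by rewrite /opM linear0 APA0 scaler0 subrr scaler0.
rewrite subrr M0 add0r (step_primal zz').
move: (opM _ _ _ _ _ _) => m eqq eqp.
have adjE : '[z'.2 - zs.2, A z'.1 - A zs.1] =
    '[z'.1 - zs.1, adjoint A z'.2 + gradient f zs.1].
  rewrite -(linearB A) innerC (adjointP bA) fixed_gradient.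
  by rewrite (zmod_morphism_linear (adjoint_linear bA)).
have pq : tau *: (p - q) = m + tau *: ((A z'.1 - A zs.1)
    - (gradient (conjugate l) z.2 - gradient (conjugate l) zs.2)).
  by rewrite scalerBr eqp eqq -addrA -scalerBr 2!opprD addrACA.
have := mulr_ge0 (ltW tau0) (subdifferential_monotone hq hp).
move: (z'.2 - zs.2) (z'.1 - zs.1) adjE => b c adjE.
have -> : tau * '[b, p - q] = '[b, m] +
    tau * ('[c, adjoint A z'.2 + gradient f zs.1]
    - '[b, gradient (conjugate l) z.2 - gradient (conjugate l) zs.2]).
  by rewrite -adjE -innerBr -!innerZr -innerDr -pq.
rewrite innerZr (innerBr _ _ c) !(innerDr _ _ c).
move: '[b, m] '[b, _ - _] => bm w.
move: '[c, adjoint A _] '[c, gradient f z.1] '[c, gradient f zs.1] => Bs g gs.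
lra.
Qed.
End iteration.

(** * The descent inequality *)

(** Here [pd], [dG] and [G] stand for [|d|^2_P], [<d, y>_P] and [|y|^2_P]. The
    left-hand side is a concave quadratic in [y], whose maximum is attained at
    [y = r^-1 d] for the [r] of the proof. *)
Lemma primal_quadratic_bound {R : realType} (beta tau theta pd G dG : R) :
  3 / 4 < theta <= 1 -> 0 < tau -> 0 < beta -> tau < 2 * beta ->
  (forall r, 0 < r -> 2 * dG <= r^-1 * pd + r * G) ->
  - pd - 2 * beta / tau * G + 2 * dG + 4 * (1 - theta) * (pd - 2 * dG + G) <=
  - ((4 * theta - 3) * (2 * beta - tau) / (2 * beta - 4 * (1 - theta) * tau))
    * pd.
Proof.
move=> /andP[th3 th1] tau0 beta0 tb young_dG.
set k := 4 * (1 - theta).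
have k0 : 0 < 1 - k by rewrite /k; lra.
have den0 : 0 < 2 * beta - k * tau.
  by rewrite subr_gt0; apply: le_lt_trans tb; rewrite ler_piMl// ltW//; lra.
pose r := (2 * beta - k * tau) / ((1 - k) * tau).
have r0 : 0 < r by rewrite divr_gt0// mulr_gt0.
have := ler_wpM2l (ltW k0) (young_dG r r0).
have -> : (1 - k) * (r^-1 * pd + r * G) = (2 * beta / tau - k) * G +
   (1 - k) * pd - (4 * theta - 3) * (2 * beta - tau) / (2 * beta - k * tau) * pd.
  by rewrite /r /k; field; rewrite -/k; lra.
lra.
Qed.

Theorem theorem1 (R : realType) (X S : hilbertType R)
  (f : X -> \bar R) (h l : S -> \bar R)
  (A : {linear X -> S}) (P : {linear X -> X}) (D : {linear S -> S})
  (tau sigma theta beta : R) (x : nat -> X) (s : nat -> S) :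
  let gradf := gradient f in
  let gradlc := gradient (conjugate l) in
  let M1 := opM1 tau sigma theta A P D in
  let Mt := opMt tau sigma theta A P D in
  let step_I := step tau sigma A P D f h l in
  let fixed_I := fixed_point tau sigma A P D f h l in
  proper_lsc_convex f -> proper_lsc_convex h -> proper_lsc_convex l ->
  frechet_differentiable f ->
  frechet_differentiable (conjugate l) ->
  bounded_op A ->
  bounded_op D -> self_adjoint D ->
  0 < tau -> 0 < sigma ->
  positive_definite P ->
  positive_definite M1 ->
  (exists z, fixed_I z) ->
  0 < beta ->
  (forall xs ss, fixed_I (xs, ss) -> forall (u : X) (v : S),
     beta * qnorm2 (inv_op P) (gradf u - gradf xs)
       <= '[u - xs, gradf u - gradf xs] /\
     beta * qnorm2 (inv_op M1) (gradlc v - gradlc ss)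
       <= '[v - ss, gradlc v - gradlc ss]) ->
  3 / 4 < theta <= 1 ->
  tau < 2 * beta ->
  (forall k, step_I (x k, s k) (x k.+1, s k.+1)) ->
  forall xs ss, fixed_I (xs, ss) -> forall k,
    qnorm2_pair P Mt ((x k.+1, s k.+1) - (xs, ss))
      - qnorm2_pair P Mt ((x k, s k) - (xs, ss))
    <= - (1 - tau / (2 * beta)) * qnorm2 M1 (s k - s k.+1)
       - (4 * theta - 3) * (2 * beta - tau)
           / (2 * beta - 4 * (1 - theta) * tau)
         * qnorm2 P (x k - x k.+1).
Proof.
move=> gradf gradlc M1 Mt step_I fixed_I _ _ _ _ _ bA _ _ tau0 sigma0 pdP pdM1 _
  beta0 coco th tb xsP xs ss fixed k.
have [cof cog] := coco _ _ fixed (x k) (s k).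
have th1 : theta <= 1 by case/andP: th.
have [linM1 _ symM1 _] := pdM1; have [linP _ symP _] := pdP.
have linM2 := opM2_linear tau theta bA pdP.
have symM2 := opM2_self_adjoint tau theta bA pdP.
have posM2 := opM2_ge0 tau bA pdP th1.
set M2 := opM2 tau theta A P in linM2 symM2 posM2.
have invP := step_dual_error_image bA pdP tau0 (xsP k) fixed.
have := step_monotone bA pdP tau0 sigma0 (xsP k) fixed.
rewrite (opM_split tau theta A P D sigma0) /= -/M1 -/M2 -/gradf -/gradlc.
rewrite -/gradf /= in invP.
have splitMt v : '[v, Mt v] = '[v, M1 v] + '[v, M2 v] by rewrite innerDr.
rewrite /qnorm2_pair /qnorm2 /= -!/(_ - _) !splitMt.
move: cof cog invP.
have <- : (s k - ss) - (s k.+1 - ss) = s k - s k.+1 by rewrite opprB addrA subrK.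
have <- : (x k - xs) - (x k.+1 - xs) = x k - x k.+1 by rewrite opprB addrA subrK.
move: (s k - ss) (s k.+1 - ss) (x k - xs) (x k.+1 - xs) => a b e c.
move: (gradf (x k) - gradf xs) (gradlc (s k) - gradlc ss) => dg dw.
move=> cof cog invP mono.
set y := tau *: inv_op P dg in invP.
have Py : P y = tau *: dg by rewrite linearZ_LR /= (inv_opK pdP).
have yy : '[y, P y] = tau ^+ 2 * '[dg, inv_op P dg].
  by rewrite Py !innerE innerC; ring.
(* The dual M2-length becomes a primal P-length. *)
have M2b : '[b, M2 b] = (1 - theta) * '[e - c - y, P (e - c - y)].
  rewrite -invP /M2 (opM2_inner tau theta P bA).
  rewrite linearZ_LR /= (inv_opK pdP) !innerE.
  by rewrite (innerC _ (adjoint A b)); ring.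
have polM1 := polarization linM1 symM1 a b.
have polM2 := polarization linM2 symM2 a b.
have polP := polarization linP symP e c.
have parM2 := parallelogram_le linM2 symM2 posM2 a b.
have boundw := cocoercive_bound pdM1 b beta0 cog.
rewrite (qformB linP symP (e - c) y) in M2b.
have boundx := primal_quadratic_bound (pd := '[e - c, P (e - c)]) th tau0 beta0 tb
  (fun r => @young _ _ _ linP symP (positive_definite_ge0 pdP) r (e - c) y).
(* The gradient at the old iterate is tested against the new primal error; the
   mismatch is the cross term <d, y>_P of the quadratic bounded in boundx. *)
have yc : tau * '[c, dg] = tau * '[e, dg] - '[e - c, P y].
  by rewrite Py innerZr innerBl; ring.
have yG : 2 * beta / tau * '[y, P y] <= 2 * tau * '[e, dg].
  have tau2 : 0 <= 2 * tau by lra.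
  rewrite yy; have := ler_wpM2l tau2 cof.
  by congr (_ <= _); rewrite /qnorm2; field; rewrite gt_eqF.
have tw : tau * (- 2 * '[b, dw]) <=
    tau / (2 * beta) * '[a - b, M1 (a - b)].
  by rewrite -mulrA ler_wpM2l// ltW.
(* Only real numbers matter from here on: the conclusion is a linear combination
   of the relations collected above. *)
move: ('[e - c, P (e - c)]) ('[y, P y]) ('[e - c, P y]) ('[c, dg]) ('[e, dg])
  ('[b, dw]) ('[c, P (e - c)]) M2b polP boundx yc yG tw mono
  => pd G dG cdg edg bdw cPd.
move: ('[a - b, M1 (a - b)]) ('[a - b, M2 (a - b)]) ('[b, M1 (a - b)])
  ('[b, M2 (a - b)]) ('[a, M1 a]) ('[b, M1 b]) ('[a, M2 a]) ('[b, M2 b])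
  polM1 polM2 parM2.
move: ('[e, P e]) ('[c, P c]) => pe pc m1ab m2ab bm1 bm2 m1a m1b m2a m2b.
lra.
Qed.
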